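(* There exist, for every integer $n\ge 10$, a tree $T_n$ and a unicyclic graph $U_n$, both of order $n$, such that: (1) for every $n\ge 10$, $T_n$ and $U_n$ have the same status sequence; (2) for every $n\ge 15$ with $n\equiv 3 \pmod 4$, the tree $T_n$ is status injective; and for any four consecutive even integers $n, n+2, n+4, n+6$ with $n\ge 15$, at least one of the trees $T_n, T_{n+2}, T_{n+4}, T_{n+6}$ is status injective.
   Context: All graphs are finite and simple. The order of a graph is its number of vertices. A connected graph is unicyclic if it has exactly one cycle. For a connected graph $G$ and a vertex $x$, the status of $x$ is $s(x)=\sum_{y\in V(G)} d(x,y)$, where $d(x,y)$ is the distance between $x$ and $y$ in $G$. The status sequence of $G$ is the list of the statuses of all vertices of $G$ arranged in nondecreasing order. $G$ is status injective if the statuses of its vertices are pairwise distinct. *)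

(* Defs.v *)
From mathcomp Require Import all_boot.

Set Implicit Arguments.
Unset Strict Implicit.
Unset Printing Implicit Defensive.

Record sgraph := SGraph {
  vertex :> finType;
  edge : rel vertex;
  edge_sym : symmetric edge;
  edge_irrefl : irreflexive edge
}.

Arguments edge {s} : rename.

Section Defs.

Variable G : sgraph.

Definition connected := forall x y : G, connect edge x y.

(* A cycle is a subgraph, hence determined by its edge set: the vertex
   sequences obtained from one another by rotation or reversal give the same
   cycle. *)
Definition cycle_edges (c : seq G) : {set {set G}} :=
  [set [set x; next c x] | x in c].

Definition is_cycle (F : {set {set G}}) :=
  exists c : seq G, [/\ 2 < size c, ucycle edge c & F = cycle_edges c].

Definition is_tree := connected /\ (forall F : {set {set G}}, ~ is_cycle F).

Definition unicyclic := connected /\ (exists! F : {set {set G}}, is_cycle F).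

Definition walk_of_length (x y : G) (k : nat) : bool :=
  [exists p : k.-tuple G, path edge x p && (last x p == y)].

(* The least length of a walk from x to y; #|G| when y is not reachable. *)
Definition dist (x y : G) : nat := find (walk_of_length x y) (iota 0 #|G|).

Definition status (x : G) : nat := \sum_(y : G) dist x y.

Definition status_seq : seq nat := sort leq [seq status x | x : G].

Definition status_injective := injective status.

End Defs.

(* Main.v *)
Require Import Defs.
From mathcomp Require Import all_boot zify.

Set Implicit Arguments.
Unset Strict Implicit.
Unset Printing Implicit Defensive.

(** Suppose a rooted tree and a rooted unicyclic graph of the same order admit a
bijection that preserves both the status and the distance to the root. Gluing the same
graph at the two roots changes the status of a vertex [x] of either gadget by the same
affine function of the distance from [x] to the root, so the status sequences stay
equal. There is such a pair of order 10, which settles the first part, and one of order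
15 whose tree is status injective.

For the second part the order 15 gadget is glued at one end of a path, and a small
branch near the middle [c] of the path. Write [s] for the status and [n] for the order.
The values of [s - s(c)] are [X^2 - 1] and [Y^2 - 9] on the two halves of the path if
[n] is odd, [X (X + 1) - 2] and [Y (Y + 1)] if [n] is even; these never coincide. The
values on the branch are linear in [n]: for [n = 3 mod 4] they are excluded by the
squares modulo 8, and for even [n] they collide only if one of [n - 4], [n - 2],
[2 n - 6], [2 n - 4] is pronic, which cannot happen for four consecutive even [n]. The
values on the gadget fall strictly between those of the path as soon as [n] is large;
the finitely many remaining [n] are checked by computation. *)

(** * Graphs presented by their distance function *)

(** These axioms characterize the distance functions of connected graphs whose edges are the pairs
    at distance 1; [gm_step] supplies the first edge of a geodesic. *)
Record graph_metric (V : finType) (D : V -> V -> nat) : Prop := GraphMetric {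
  gm_eq0 : forall u v, D u v = 0 <-> u = v;
  gm_sym : forall u v, D u v = D v u;
  gm_tri : forall u v w, D u w <= D u v + D v w;
  gm_step : forall u v, 0 < D u v -> exists w, D u w = 1 /\ (D w v).+1 = D u v
}.

Section MetricGraph.

Variables (V : finType) (D : V -> V -> nat) (gmD : graph_metric D).

Lemma gm_refl u : D u u = 0.
Proof. exact/(gm_eq0 gmD). Qed.

Lemma metric_edge_sym : symmetric (fun u v => D u v == 1).
Proof. by move=> u v; rewrite (gm_sym gmD). Qed.

Lemma metric_edge_irrefl : irreflexive (fun u v => D u v == 1).
Proof. by move=> u; rewrite gm_refl. Qed.

Definition metric_graph : sgraph := SGraph metric_edge_sym metric_edge_irrefl.

Lemma metric_edgeE (u v : metric_graph) : edge u v = (D u v == 1).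
Proof. by []. Qed.

Lemma metric_le_path (u : metric_graph) p : path edge u p -> D u (last u p) <= size p.
Proof.
elim: p u => [|w p IHp] u /=; first by rewrite gm_refl.
case/andP=> /eqP uw /IHp le_p; apply: leq_trans (gm_tri gmD u w _) _.
by rewrite uw add1n.
Qed.

Lemma metric_geodesic (u v : metric_graph) :
  exists p, [/\ path edge u p, last u p = v & size p = D u v].
Proof.
move Dk: (D u v) => k; elim: k u Dk => [|k IHk] u Dk.
  by exists [::]; split=> //; apply/(gm_eq0 gmD).
have [|w [uw wv]] := gm_step gmD (u := u) (v := v); first by rewrite Dk.
have [|p [pw pl ps]] := IHk w; first by move: wv; rewrite Dk => -[].
by exists (w :: p); split=> //=; [rewrite uw eqxx | rewrite ps].
Qed.

(** On the way to [v] the distance to [v] takes every value from [D u v] down to 0, at distinct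
    vertices. Strictness matters because [dist] only searches lengths below [#|G|]. *)
Lemma metric_lt_card (u v : V) : D u v < #|V|.
Proof.
have lev k : k <= D u v -> exists w, D w v == k.
  move=> lek; rewrite -(subKn lek); move: (D u v - k) (leq_subr k (D u v)) => j.
  elim: j => [|j IHj] ltj; first by exists u; rewrite subn0.
  have [w /eqP Dw] := IHj (ltnW ltj).
  have [|x [_ xv]] := gm_step gmD (u := w) (v := v); first by rewrite Dw subn_gt0.
  by exists x; apply/eqP; rewrite subnS -Dw -xv.
pose f (i : 'I_(D u v).+1) := xchoose (lev i (ltn_ord i)).
have fP i : D (f i) v = i by apply/eqP/(xchooseP (lev i (ltn_ord i))).
have f_inj : injective f by move=> i j eqf; apply: val_inj; rewrite /= -!fP eqf.
by rewrite -[(D u v).+1]card_ord; apply: leq_card f_inj.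
Qed.

Lemma metric_dist (u v : metric_graph) : dist u v = D u v.
Proof.
have walkP k : walk_of_length u v k -> D u v <= k.
  case/existsP=> p /andP[pu /eqP lp].
  by rewrite -lp -[X in _ <= X](size_tuple p); apply: metric_le_path.
have walkD : walk_of_length u v (D u v).
  have [p [pu lp sp]] := metric_geodesic u v.
  by apply/existsP; exists (tcast sp (in_tuple p)); rewrite val_tcast pu lp eqxx.
have ltD := metric_lt_card u v.
rewrite /dist; set a := walk_of_length u v.
have ha : has a (iota 0 #|metric_graph|).
  by apply/hasP; exists (D u v); rewrite ?mem_iota.
apply/eqP; rewrite eqn_leq; apply/andP; split.
  rewrite leqNgt; apply/negP=> lt; have := before_find 0 lt.
  by rewrite nth_iota // add0n /a walkD.
have := nth_find 0 ha; rewrite has_find size_iota in ha.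
by rewrite nth_iota // add0n => /walkP.
Qed.

Lemma metric_status (u : metric_graph) : status u = \sum_v D u v.
Proof. by apply: eq_bigr => v _; apply: metric_dist. Qed.

Lemma metric_connected : connected metric_graph.
Proof.
move=> u v; have [p [pu lp _]] := metric_geodesic u v.
by apply/connectP; exists p.
Qed.

End MetricGraph.

(** * Cycles and ranks *)

Section Cycles.

Variable G : sgraph.

(** If both neighbours agreed, two steps of [next] would return to [x], leaving at most two
    vertices. *)
Lemma next_neq_prev (c : seq G) x :
  uniq c -> 2 < size c -> x \in c -> next c x != prev c x.
Proof.
move=> Uc sc xc; apply/eqP=> eq_np.
have nn : next c (next c x) = x by rewrite eq_np next_prev.
have [i s rot_c] := rot_to xc.
move: nn; rewrite -!(next_rot i Uc) rot_c.
have: uniq (x :: s) by rewrite -rot_c rot_uniq.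
have: 2 < size (x :: s) by rewrite -rot_c size_rot.
case: s {rot_c} => [|y [|z s]] //= _; rewrite !inE !negb_or !eqxx.
by case/andP=> /and3P[xy xz _] _; rewrite eq_sym (negPf xy) => zx; rewrite zx eqxx in xz.
Qed.

Lemma cycle_edge_next (c : seq G) x : ucycle edge c -> x \in c -> edge x (next c x).
Proof. by case/andP=> cyc_c _; apply: next_cycle. Qed.

Lemma cycle_edge_prev (c : seq G) x : ucycle edge c -> x \in c -> edge x (prev c x).
Proof. by case/andP=> cyc_c _ xc; rewrite edge_sym; apply: prev_cycle. Qed.

Lemma cycle_rank_max (rk : G -> nat) (c : seq G) : 2 < size c -> ucycle edge c ->
  exists u, [/\ u \in c, forall v, v \in c -> rk v <= rk u
    & exists v w, [/\ v != w, edge u v, edge u w, rk v <= rk u & rk w <= rk u]].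
Proof.
move=> sc Cc; have [x xc] : exists x, x \in c.
  by case: c sc {Cc} => // x c _; exists x; rewrite mem_head.
case: (@arg_maxnP _ x (mem c) rk xc) => u uc maxu.
exists u; split=> //; exists (next c u), (prev c u).
have /andP[_ Uc] := Cc.
split; [exact: next_neq_prev | exact: cycle_edge_next | exact: cycle_edge_prev | |].
  by apply: maxu; rewrite inE mem_next.
by apply: maxu; rewrite inE mem_prev.
Qed.

(* Around a cycle, a vertex of maximal rank has two neighbours of no larger rank. *)
Lemma acyclic_rank (rk : G -> nat) :
  (forall u v w, edge u v -> edge u w -> rk v <= rk u -> rk w <= rk u -> v = w) ->
  forall F : {set {set G}}, ~ is_cycle F.
Proof.
move=> uniq_down F [c [sc Cc _]].
have [u [_ _ [v [w [/eqP neq_vw uv uw vu wu]]]]] := cycle_rank_max rk sc Cc.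
exact/neq_vw/(uniq_down u).
Qed.

(** Without chords, each step of [c] follows [c0] forwards or backwards. The vertices of [c] are
    then closed under [next c0], so [c] visits all of [c0]. *)
Lemma chordless_cycle_edges (c0 c : seq G) :
  2 < size c0 -> ucycle edge c0 ->
  (forall x y, x \in c0 -> y \in c0 -> edge x y -> y = next c0 x \/ y = prev c0 x) ->
  2 < size c -> ucycle edge c -> {subset c <= c0} ->
  cycle_edges c = cycle_edges c0.
Proof.
move=> sc0 Cc0 chord sc Cc sub.
have /andP[_ Uc0] := Cc0; have /andP[_ Uc] := Cc.
have nbr x : x \in c ->
    (next c x = next c0 x /\ prev c x = prev c0 x) \/
    (next c x = prev c0 x /\ prev c x = next c0 x).
  move=> xc; have neq := next_neq_prev Uc sc xc.
  have xc0 := sub x xc.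
  have := chord x (next c x) xc0; have := chord x (prev c x) xc0.
  rewrite !sub ?mem_next ?mem_prev // cycle_edge_next // cycle_edge_prev //.
  move=> /(_ isT isT) [] p /(_ isT isT) [] q; rewrite p q ?eqxx // in neq *.
    by right.
  by left.
have sub0 : {subset c0 <= c}.
  have [x xc] : exists x, x \in c.
    by case: (c) sc => // x s _; exists x; rewrite mem_head.
  move=> y; rewrite -(fconnect_cycle (cycle_next Uc0) (sub x xc)).
  suff clo : fclosed (next c0) (mem c).
    by move=> xy; have := closed_connect clo xy; rewrite xc => <-.
  apply: (intro_closed (fconnect_sym (can_inj (prev_next Uc0)))).
  move=> z _ /eqP <- zc.
  by case: (nbr z zc) => -[n p]; rewrite -?n -?p ?mem_next ?mem_prev.
apply/setP=> F; apply/imsetP/imsetP => -[x xc ->].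
  case: (nbr x xc) => -[n p]; first by exists x; rewrite ?n ?sub.
  exists (next c x); rewrite ?sub ?mem_next // n next_prev //.
  by rewrite setUC.
have {}xc : x \in c by apply: sub0.
case: (nbr x xc) => -[n p]; first by exists x; rewrite ?n.
exists (prev c x); rewrite ?mem_prev // next_prev // p.
by rewrite setUC.
Qed.

(** A vertex of maximal rank on any cycle must lie on [c0], where the rank is 0; hence the whole
    cycle has rank 0 and stays inside the chordless [c0]. *)
Lemma unicyclic_rank (rk : G -> nat) (c0 : seq G) :
  connected G -> 2 < size c0 -> ucycle edge c0 ->
  (forall x y, x \in c0 -> y \in c0 -> edge x y -> y = next c0 x \/ y = prev c0 x) ->
  (forall u, (rk u == 0) = (u \in c0)) ->
  (forall u v w, u \notin c0 ->
     edge u v -> edge u w -> rk v <= rk u -> rk w <= rk u -> v = w) ->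
  unicyclic G.
Proof.
move=> conn sc0 Cc0 chord rk0 uniq_down; split=> //.
exists (cycle_edges c0); split; first by exists c0.
move=> F [c [sc Cc ->]]; apply/esym/chordless_cycle_edges => //.
have [u [uc maxu [v [w [/eqP neq_vw uv uw vu wu]]]]] := cycle_rank_max rk sc Cc.
have uc0 : u \in c0 by apply/negPn/negP=> /uniq_down/(_ uv uw vu wu).
move: uc0; rewrite -rk0 => /eqP u0 x xc.
by rewrite -rk0 -leqn0 -u0 maxu.
Qed.

End Cycles.

(** * Rooted trees and paths *)

(** This is the hypothesis of [acyclic_rank] with the distance to [r] as rank. *)
Definition tree_metric_at (V : finType) (D : V -> V -> nat) (r : V) :=
  forall u v w, D u v = 1 -> D u w = 1 ->
    D v r <= D u r -> D w r <= D u r -> v = w.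

Definition path_dist P (i j : 'I_P) : nat := (i - j) + (j - i).

Lemma path_metric P : graph_metric (@path_dist P).
Proof.
rewrite /path_dist; split=> [u v|u v|u v w|u v].
- split=> [d0|->]; last by rewrite subnn.
  by apply: val_inj => /=; lia.
- by rewrite addnC.
- by lia.
- case: (ltngtP u v) => [lt_uv _|lt_vu _|->]; last by rewrite subnn.
    have ltP : u.+1 < P by apply: leq_ltn_trans (ltn_ord v).
    by exists (Ordinal ltP) => /=; lia.
  have ltP : u.-1 < P by apply: leq_ltn_trans (ltn_ord u); apply: leq_pred.
  by exists (Ordinal ltP) => /=; lia.
Qed.

Lemma path_tree_at P r : tree_metric_at (@path_dist P) r.
Proof. by rewrite /path_dist => u v w uv uw vu wu; apply: val_inj => /=; lia. Qed.

(** The two sides of [i] contribute one triangular number each; doubling avoids the halves. *)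
Lemma path_dist_sum P (i : 'I_P) :
  (\sum_j path_dist i j).*2 = i * i.+1 + (P - i) * (P.-1 - i).
Proof.
(* The value [k = m], one place past the last vertex, is allowed: the case [k = m.+1] of the
   induction adds 1 to every distance from [m]. *)
have sumE m (k : nat) : k <= m ->
    (\sum_(j < m) ((k - j) + (j - k))).*2 = k * k.+1 + (m - k) * (m.-1 - k).
  elim: m k => [|m IHm] k lekm.
    by rewrite big_ord0; move: lekm; rewrite leqn0 => /eqP->.
  rewrite big_ord_recr /= doubleD; case: (ltngtP k m.+1) lekm => // [ltk|->] _.
    by rewrite IHm //; nia.
  have -> : \sum_(j < m) (m.+1 - j + (j - m.+1)) = \sum_(j < m) ((m - j + (j - m)).+1).
    by apply: eq_bigr => j _; have := ltn_ord j; lia.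
  under eq_bigr do rewrite -addn1.
  rewrite big_split /= sum1_card card_ord doubleD IHm //; nia.
by rewrite /path_dist sumE // ltnW.
Qed.

(** * Gluing two rooted graphs *)

(** The root [ord0] of a glued graph becomes a vertex of the host, so only the other [k] vertices
    are added. *)
Definition hair_vertex k (x : 'I_k) : 'I_k.+1 := lift ord0 x.

Lemma hair_vertex_inj k : injective (@hair_vertex k).
Proof. exact: lift_inj. Qed.

Lemma hair_vertexP k (z : 'I_k.+1) : z = ord0 \/ exists y, z = hair_vertex y.
Proof. by case: (unliftP ord0 z) => [y ->|->]; [right; exists y | left]. Qed.

Section Glue.

Variables (V : finType) (D : V -> V -> nat) (v0 : V).
Variables (k : nat) (A : 'I_k.+1 -> 'I_k.+1 -> nat).

Definition glue_dist (u v : V + 'I_k) : nat :=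
  match u, v with
  | inl u, inl v => D u v
  | inl u, inr x | inr x, inl u => D u v0 + A ord0 (hair_vertex x)
  | inr x, inr y => A (hair_vertex x) (hair_vertex y)
  end.

Hypotheses (gmD : graph_metric D) (gmA : graph_metric A).

Lemma glue_root_gt0 x : 0 < A ord0 (hair_vertex x).
Proof. by rewrite lt0n; apply/eqP => /(gm_eq0 gmA). Qed.

Lemma glue_metric : graph_metric glue_dist.
Proof.
have symD := gm_sym gmD; have symA := gm_sym gmA.
have triD := gm_tri gmD; have triA := gm_tri gmA.
have D0 := gm_refl gmD; have A_gt0 := glue_root_gt0.
split.
- move=> [u|x] [v|y] /=.
  + by rewrite (gm_eq0 gmD); split=> [->|[]].
  + by have := A_gt0 y; split=> //; lia.
  + by have := A_gt0 x; split=> //; lia.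
  + by rewrite (gm_eq0 gmA); split=> [/hair_vertex_inj->|[->]].
- by move=> [u|x] [v|y] /=.
- move=> [u|x] [v|y] [w|z] //=.
  + by have := triD u v v0; lia.
  + by have := triD u v0 w; rewrite (symD v0 w); lia.
  + by have := triA ord0 (hair_vertex y) (hair_vertex z); lia.
  + by have := triD w v v0; rewrite (symD w v); lia.
  + have := triA (hair_vertex x) ord0 (hair_vertex z).
    by rewrite (symA (hair_vertex x) ord0); lia.
  + have := triA ord0 (hair_vertex y) (hair_vertex x).
    by rewrite (symA (hair_vertex y)); lia.
- move=> [u|x] [v|y] /=.
  + by case/(gm_step gmD) => w [uw wv]; exists (inl w).
  + move=> _; have [uv0|neq] := eqVneq u v0.
      rewrite uv0 D0 add0n; have [z [uz zy]] := gm_step gmA (A_gt0 y).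
      case: (hair_vertexP z) uz zy => [->|[t ->]] uz zy.
        by rewrite (gm_refl gmA) in uz.
      by exists (inr t) => /=; lia.
    have: 0 < D u v0 by rewrite lt0n; apply/eqP=> /(gm_eq0 gmD)/eqP; apply/negP.
    by case/(gm_step gmD) => w [uw wv]; exists (inl w); rewrite /= uw; lia.
  + move=> _; have := A_gt0 x; rewrite symA => /(gm_step gmA) [z [uz zy]].
    case: (hair_vertexP z) uz zy => [->|[t ->]] uz zy.
      rewrite (gm_refl gmA) symA in zy; have := symD v0 v; have := D0 v0.
      by exists (inl v0) => /=; rewrite [X in _ + X]symA; lia.
    by exists (inr t) => /=; rewrite (symA ord0 (hair_vertex t)); lia.
  + case/(gm_step gmA) => z [uz zy].
    case: (hair_vertexP z) uz zy => [->|[t ->]] uz zy; last by exists (inr t).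
    by exists (inl v0); rewrite /= D0 symA uz; lia.
Qed.

(** Only [v0] gains neighbours in the host, and these are farther from [r]. On added vertices the
    distance to [r] exceeds the distance to [ord0] by a constant. *)
Lemma glue_tree_at r :
  tree_metric_at D r -> tree_metric_at A ord0 -> tree_metric_at glue_dist (inl r).
Proof.
move=> trD trA; have symA := gm_sym gmA; have A_gt0 := glue_root_gt0.
have Dv0 u : D u v0 = 0 -> u = v0 by move/(gm_eq0 gmD).
have symD := gm_sym gmD; have D0 := gm_refl gmD.
have down (x y : 'I_k) : D r v0 + A ord0 (hair_vertex y) <= D r v0 + A ord0 (hair_vertex x) ->
    A (hair_vertex y) ord0 <= A (hair_vertex x) ord0.
  by rewrite !(symA _ ord0) leq_add2l.
move=> [u|x] [v|y] [w|z] /=.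
- by move=> uv uw vu wu; congr inl; apply: (trD u).
- move=> _ uw _; have := A_gt0 z => Az wu.
  have /Dv0 uv0 : D u v0 = 0 by lia.
  by move: wu; rewrite uv0 (symD v0); lia.
- move=> uv _; have := A_gt0 y => Ay vu _.
  have /Dv0 uv0 : D u v0 = 0 by lia.
  by move: vu; rewrite uv0 (symD v0); lia.
- move=> uv _; have := A_gt0 y => Ay vu _.
  have /Dv0 uv0 : D u v0 = 0 by lia.
  by move: vu; rewrite uv0 (symD v0); lia.
- move=> xv xw _ _; have := A_gt0 x => Ax.
  have -> : v = v0 by apply: Dv0; lia.
  by have -> : w = v0 by apply: Dv0; lia.
- move=> xv xz _ /down zx; have := A_gt0 x => Ax.
  have := trA (hair_vertex x) (hair_vertex z) ord0 xz.
  rewrite zx (gm_refl gmA) => /(_ _ isT isT) zE; have // : hair_vertex z = ord0.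
  by apply: zE; rewrite symA; lia.
- move=> xy xw /down yx _; have := A_gt0 x => Ax.
  have := trA (hair_vertex x) (hair_vertex y) ord0 xy.
  rewrite yx (gm_refl gmA) => /(_ _ isT isT) zE; have // : hair_vertex y = ord0.
  by apply: zE; rewrite symA; lia.
- move=> xy xz /down yx /down zx.
  by rewrite (hair_vertex_inj (trA _ _ _ xy xz yx zx)).
Qed.

Lemma glue_sum_inl u :
  \sum_v glue_dist (inl u) v = \sum_v D u v + (k * D u v0 + \sum_x A ord0 x).
Proof.
rewrite big_sumType /= big_split /= sum_nat_const card_ord.
by rewrite [\sum_(x < k.+1) _]big_ord_recl (gm_refl gmA).
Qed.

(** The root is already counted in the last sum, so the distance to it is added once for each host
    vertex other than [v0]. *)
Lemma glue_sum_inr x :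
  \sum_v glue_dist (inr x) v =
  \sum_v D v0 v + (#|V|.-1 * A ord0 (hair_vertex x) + \sum_y A (hair_vertex x) y).
Proof.
rewrite big_sumType /= big_split /= sum_nat_const.
rewrite [\sum_(y < k.+1) _]big_ord_recl (gm_sym gmA _ ord0).
rewrite (eq_bigr (D v0)) => [|v _]; last exact: (gm_sym gmD).
have : 0 < #|V| by apply/card_gt0P; exists v0.
by case: #|V| => // m _ /=; rewrite mulSn -!addnA; congr (_ + _); rewrite addnCA.
Qed.

End Glue.

(** * Finite distance tables *)

Section Tables.

Variable t : seq (seq nat).

Definition entry i j : nat := nth 0 (nth [::] t i) j.

Let k := (size t).-1.
Let idx := iota 0 k.+1.

Definition table_dist (i j : 'I_k.+1) : nat := entry i j.

Definition table_metricb :=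
  all (fun i => all (fun j =>
    [&& (entry i j == 0) == (i == j), entry i j == entry j i,
        all (fun l => entry i l <= entry i j + entry j l) idx &
        (0 < entry i j) ==>
          has (fun l => (entry i l == 1) && ((entry l j).+1 == entry i j)) idx])
  idx) idx.

Definition table_treeb :=
  all (fun i => all (fun j => all (fun l =>
    [&& entry i j == 1, entry i l == 1,
        entry j 0 <= entry i 0 & entry l 0 <= entry i 0] ==> (j == l))
  idx) idx) idx.

(** Distance from [i] to the vertices of [c]; in a metric table the default [k.+1] exceeds every
    distance. *)
Definition cycle_rank (c : seq nat) i := foldr minn k.+1 [seq entry i j | j <- c].

(** A decidable form of the hypotheses of [unicyclic_rank]. The cycle avoids vertex 0, so that it
    lies among the vertices added by gluing. *)
Definition table_unicyclicb (c : seq nat) :=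
  [&& 2 < size c, uniq c, all (fun j => 0 < j <= k) c,
      cycle (fun i j => entry i j == 1) c,
      all (fun i => all (fun j =>
        (entry i j == 1) ==> (j == next c i) || (j == prev c i)) c) c,
      all (fun i => (cycle_rank c i == 0) == (i \in c)) idx &
      all (fun i => (i \in c) || all (fun j => all (fun l =>
        [&& entry i j == 1, entry i l == 1,
            cycle_rank c j <= cycle_rank c i & cycle_rank c l <= cycle_rank c i]
        ==> (j == l)) idx) idx) idx].

Let idxP (i : 'I_k.+1) : val i \in idx.
Proof. by rewrite mem_iota /= add0n. Qed.

Lemma table_metric : table_metricb -> graph_metric table_dist.
Proof.
move/allP=> chk; rewrite /table_dist.
have {}chk (i j : 'I_k.+1) := and4P (allP (chk _ (idxP i)) _ (idxP j)).
split=> [i j|i j|i j l|i j].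
- have [/eqP e0 _ _ _] := chk i j; split=> [/eqP|->].
    by rewrite e0 => /eqP/val_inj.
  by apply/eqP; have [/eqP-> _ _ _] := chk j j.
- by have [_ /eqP] := chk i j.
- by have [_ _ /allP/(_ _ (idxP l))] := chk i j.
- have [_ _ _ /implyP st] := chk i j; move/st=> /hasP[l].
  rewrite mem_iota /= add0n => ltl /andP[/eqP il /eqP lj].
  by exists (Ordinal ltl).
Qed.

Lemma table_tree_at : table_treeb -> tree_metric_at table_dist ord0.
Proof.
move/allP=> chk i j l; rewrite /table_dist /= => ij il ji li; apply: val_inj => /=.
have := allP (allP (chk _ (idxP i)) _ (idxP j)) _ (idxP l).
by rewrite /= ij il ji li => /eqP.
Qed.

Section GlueUnicyclic.

Variables (V : finType) (D : V -> V -> nat) (v0 : V).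
Hypotheses (gmD : graph_metric D) (trD : tree_metric_at D v0).
Hypothesis (gmt : graph_metric table_dist).

Let G := metric_graph (glue_metric v0 gmD gmt).

Lemma glue_unicyclic (c : seq nat) : table_unicyclicb c -> unicyclic G.
Proof.
case/and5P=> sc Uc /allP c_bd cyc_c /and3P[/allP chord /allP rk0 /allP down].
(* Added vertices are numbered from 0 in ['I_k] but from 1 in the table. *)
have [c1 c1E] : exists c1 : seq 'I_k, [seq x.+1 | x : 'I_k <- c1] = c.
  elim: (c) c_bd => [|j s IHs] bd; first by exists [::].
  have [|s1 s1E] := IHs; first by move=> i si; apply: bd; rewrite inE si orbT.
  have /andP[j_gt0 lejk] := bd j (mem_head _ _).
  have ltj : j.-1 < k by rewrite prednK.
  by exists (Ordinal ltj :: s1); rewrite /= s1E prednK.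
have S_inj : injective (fun x : 'I_k => x.+1) by move=> x y [] /val_inj.
have inr_inj : injective (inr : 'I_k -> G) by move=> x y [].
have hvE (x : 'I_k) : hair_vertex x = x.+1 :> nat by [].
pose c0 : seq G := [seq inr x | x <- c1].
(* The distance to the cycle in the glued graph; from the host every path to the cycle passes
   through the root. *)
pose rk (u : G) := match u with
  | inl v => cycle_rank c 0 + D v v0
  | inr x => cycle_rank c x.+1 end.
have Uc1 : uniq c1 by rewrite -(map_inj_uniq S_inj) c1E.
have memc (x : 'I_k) : (x.+1 \in c) = (x \in c1) by rewrite -c1E (mem_map S_inj).
have mem0 (x : 'I_k) : ((inr x : G) \in c0) = (x \in c1) by rewrite (mem_map inr_inj).
have mem0l v : (inl v : G) \notin c0 by apply/negP=> /mapP[].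
have c0' : 0 \notin c by apply/negP => /c_bd.
have nextE (x : 'I_k) : next c x.+1 = (next c1 x).+1 by rewrite -c1E (next_map S_inj).
have prevE (x : 'I_k) : prev c x.+1 = (prev c1 x).+1 by rewrite -c1E (prev_map S_inj).
have rk0l : cycle_rank c 0 != 0.
  by have := rk0 _ (idxP ord0); rewrite /= (negPf c0') => /eqP->.
have downP (i j l : 'I_k.+1) : val i \notin c ->
    table_dist i j = 1 -> table_dist i l = 1 ->
    cycle_rank c j <= cycle_rank c i -> cycle_rank c l <= cycle_rank c i -> j = l.
  move=> nic ij il ji li; have := down _ (idxP i); rewrite (negPf nic) orFb.
  move=> /allP/(_ _ (idxP j))/allP/(_ _ (idxP l)).
  by rewrite ji li !andbT; rewrite /table_dist in ij il; rewrite ij il => /eqP/val_inj.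
have symt := gm_sym gmt; have D0 := gm_refl gmD.
have t_gt0 := glue_root_gt0 gmt.
have Dv0 u : D u v0 = 0 -> u = v0 by move/(gm_eq0 gmD).
apply: (@unicyclic_rank G rk c0).
- exact: metric_connected.
- by move: sc; rewrite -c1E !size_map.
- rewrite /ucycle (map_inj_uniq inr_inj) Uc1 andbT.
  by move: cyc_c; rewrite -c1E !cycle_map.
- move=> u v /mapP[x xc1 ->] /mapP[y yc1 ->]; rewrite metric_edgeE /= => xy.
  have := chord x.+1; rewrite memc xc1 => /(_ isT)/allP/(_ y.+1).
  rewrite memc yc1 => /(_ isT); rewrite /table_dist !hvE in xy; rewrite xy /=.
  rewrite nextE prevE !eqSS !(next_map inr_inj, prev_map inr_inj) //.
  by case/orP=> /eqP/val_inj->; [left | right].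
- move=> [v|x]; first by rewrite (negPf (mem0l v)) /=; lia.
  by have /eqP := rk0 x.+1 (idxP (hair_vertex x)); rewrite /= memc mem0.
- move=> [u|x] [v|y] [w|z] nuc; rewrite !metric_edgeE /= => /eqP uv /eqP uw.
  + by rewrite !leq_add2l => vu wu; congr inl; apply: (trD uv uw).
  + have := t_gt0 z => tz; have /Dv0 uv0 : D u v0 = 0 by lia.
    by rewrite !leq_add2l uv0 D0 => vu; move: uv; rewrite uv0 (gm_sym gmD); lia.
  + have := t_gt0 y => tz; have /Dv0 uv0 : D u v0 = 0 by lia.
    by rewrite !leq_add2l uv0 D0 => _ wu; move: uw; rewrite uv0 (gm_sym gmD); lia.
  + have := t_gt0 y => tz; have /Dv0 uv0 : D u v0 = 0 by lia.
    rewrite uv0 D0 add0n in uv uw; rewrite uv0 D0 addn0 => yx zx.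
    have // := downP ord0 (hair_vertex y) (hair_vertex z) c0' uv uw yx zx.
    by move/hair_vertex_inj->.
  + have := t_gt0 x => tx; have -> : v = v0 by apply: Dv0; lia.
    by have -> : w = v0 by apply: Dv0; lia.
  + have := t_gt0 x => tx; have /Dv0 vv0 : D v v0 = 0 by lia.
    rewrite vv0 D0 addn0 add0n symt in uv * => rv rz.
    have := downP (hair_vertex x) ord0 (hair_vertex z).
    by rewrite hvE memc -mem0 => /(_ nuc uv uw rv rz).
  + have := t_gt0 x => tx; have /Dv0 vv0 : D w v0 = 0 by lia.
    rewrite vv0 D0 addn0 add0n symt in uw * => rv rz.
    have := downP (hair_vertex x) (hair_vertex y) ord0.
    by rewrite hvE memc -mem0 => /(_ nuc uv uw rv rz).
  + move=> rv rz; have := downP (hair_vertex x) (hair_vertex y) (hair_vertex z).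
    by rewrite hvE memc -mem0 => /(_ nuc uv uw rv rz)/hair_vertex_inj->.
Qed.

End GlueUnicyclic.

End Tables.

Lemma glue_tree (V : finType) (D : V -> V -> nat) (v0 r : V) (k : nat)
    (A : 'I_k.+1 -> 'I_k.+1 -> nat) (gmD : graph_metric D) (gmA : graph_metric A) :
  tree_metric_at D r -> tree_metric_at A ord0 ->
  is_tree (metric_graph (glue_metric v0 gmD gmA)).
Proof.
move=> trD trA; split; first exact: metric_connected.
apply: (@acyclic_rank (metric_graph _) (fun u => glue_dist D v0 A u (inl r))) => u v w.
by rewrite !metric_edgeE => /eqP uv /eqP uw; apply: (glue_tree_at gmD gmA trD trA).
Qed.

(** * A path with two rooted graphs glued to it *)

(* Vertex 0 of the table is the root, which is identified with a vertex of the host. *)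
Record hair := Hair {
  hair_table :> seq (seq nat);
  hair_metric : table_metricb hair_table
}.

Definition row_sum (t : seq (seq nat)) i :=
  sumn [seq entry t i j | j <- iota 0 (size t).-1.+1].

Definition gap i j : nat := (i - j) + (j - i).

(** Status of vertex [i] in the path on the vertices from 0 to [m]. *)
Definition path_sum m i := (i * i.+1 + (m.+1 - i) * (m - i))./2.

Lemma sum_table_dist t (i : 'I_(size t).-1.+1) : \sum_j table_dist i j = row_sum t i.
Proof.
rewrite /row_sum.
have -> : iota 0 (size t).-1.+1 = index_iota 0 (size t).-1.+1.
  by rewrite /index_iota subn0.
by rewrite sumnE big_map big_mkord.
Qed.

Lemma map_enum_ord (R : Type) k (f : nat -> R) :
  [seq f (val x) | x <- enum 'I_k] = [seq f i | i <- iota 0 k].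
Proof. by rewrite -val_enum_ord -map_comp. Qed.

Lemma map_enum_sum (T1 T2 : finType) (R : Type) (f : T1 + T2 -> R) :
  [seq f x | x : T1 + T2] =
  [seq f (inl x) | x : T1] ++ [seq f (inr x) | x : T2].
Proof. by rewrite /image_mem !enumT [in LHS]unlock /= map_cat -!map_comp. Qed.

Section Assemble.

Variables (m p q : nat) (E : hair).

Definition base_dist :=
  glue_dist (@path_dist m.+1) (inord p) (@table_dist E).

Lemma base_metric : graph_metric base_dist.
Proof. exact: glue_metric (@path_metric _) (table_metric (hair_metric E)). Qed.

Lemma base_tree_at (i : 'I_m.+1) : table_treeb E -> tree_metric_at base_dist (inl i).
Proof.
move=> trE; apply: glue_tree_at; first exact: path_metric.
- exact: table_metric (hair_metric E).
- exact: path_tree_at.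
- exact: table_tree_at.
Qed.

(** The gadget [A] is glued last, so that [glue_tree] and [glue_unicyclic] both apply with a tree as
    host. *)
Definition assemble (A : hair) : sgraph :=
  metric_graph (glue_metric (inl (inord q)) base_metric (table_metric (hair_metric A))).

Lemma assemble_tree (A : hair) : table_treeb E -> table_treeb A -> is_tree (assemble A).
Proof.
move=> trE trA; apply: (@glue_tree _ _ _ (inl ord0)); first exact: base_tree_at.
exact: table_tree_at.
Qed.

Lemma assemble_unicyclic (A : hair) c :
  table_treeb E -> table_unicyclicb A c -> unicyclic (assemble A).
Proof. by move=> trE; apply: glue_unicyclic; apply: base_tree_at. Qed.

Lemma card_assemble (A : hair) : #|assemble A| = m.+1 + (size E).-1 + (size A).-1.
Proof. by rewrite /assemble /= !card_sum !card_ord. Qed.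

Hypotheses (lepm : p <= m) (leqm : q <= m).

Definition spine_status (A : hair) i :=
  path_sum m i + ((size E).-1 * gap i p + row_sum E 0)
  + ((size A).-1 * gap i q + row_sum A 0).

Definition branch_status (A : hair) x :=
  path_sum m p + (m * entry E 0 x + row_sum E x)
  + ((size A).-1 * (gap q p + entry E 0 x) + row_sum A 0).

Definition gadget_status (ds : nat * nat) :=
  path_sum m q + ((size E).-1 * gap q p + row_sum E 0)
  + ((m + (size E).-1) * ds.1 + ds.2).

(** With the host fixed, the statuses of the gadget vertices depend on the gadget through these
    pairs alone. *)
Definition profile (t : seq (seq nat)) :=
  [seq (entry t 0 x, row_sum t x) | x <- iota 1 (size t).-1].

Definition statuses (A : hair) :=
  [seq spine_status A i | i <- iota 0 m.+1] ++
  [seq branch_status A x | x <- iota 1 (size E).-1] ++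
  [seq gadget_status ds | ds <- profile A].

Lemma path_sumE (i : 'I_m.+1) : \sum_j path_dist i j = path_sum m i.
Proof. by rewrite -[LHS]doubleK path_dist_sum. Qed.

Lemma sum_base_inl (i : 'I_m.+1) :
  \sum_v base_dist (inl i) v = path_sum m i + ((size E).-1 * gap i p + row_sum E 0).
Proof.
rewrite glue_sum_inl; last exact: table_metric (hair_metric E).
by rewrite path_sumE sum_table_dist /path_dist inordK.
Qed.

Lemma sum_base_inr x :
  \sum_v base_dist (inr x) v = path_sum m p + (m * entry E 0 x.+1 + row_sum E x.+1).
Proof.
rewrite glue_sum_inr; first last.
- exact: table_metric (hair_metric E).
- exact: path_metric.
by rewrite path_sumE sum_table_dist card_ord inordK.
Qed.

Lemma status_list (A : hair) : [seq status x | x : assemble A] = statuses A.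
Proof.
have gmE := base_metric; have gmA := table_metric (hair_metric A).
rewrite /statuses map_enum_sum map_enum_sum -catA; congr (_ ++ (_ ++ _)).
- rewrite -map_enum_ord; apply: eq_map => i.
  rewrite metric_status glue_sum_inl // sum_base_inl sum_table_dist.
  by rewrite /spine_status /base_dist /= /path_dist inordK.
- rewrite -[1]/(1 + 0) iotaDl -map_comp -map_enum_ord; apply: eq_map => x /=.
  rewrite metric_status glue_sum_inl // sum_base_inr sum_table_dist.
  by rewrite /branch_status /base_dist /= /path_dist /gap !inordK.
- rewrite /profile -[1]/(1 + 0) iotaDl -!map_comp -map_enum_ord; apply: eq_map => x /=.
  rewrite metric_status glue_sum_inr // sum_base_inl sum_table_dist.
  by rewrite /gadget_status /= inordK // card_sum !card_ord.
Qed.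

Lemma assemble_injective (A : hair) : uniq (statuses A) -> status_injective (assemble A).
Proof. by rewrite -status_list => /injectiveP. Qed.

(** The path and branch statuses see the gadget only through its size and the row sum of its
    root. *)
Lemma assemble_status_seq (A B : hair) :
  size A = size B -> row_sum A 0 = row_sum B 0 -> perm_eq (profile A) (profile B) ->
  status_seq (assemble A) = status_seq (assemble B).
Proof.
move=> sAB rAB pAB; apply/perm_sortP.
- exact: leq_total.
- exact: leq_trans.
- exact: anti_leq.
rewrite !status_list /statuses /spine_status /branch_status sAB rAB.
by rewrite !perm_cat2l perm_map.
Qed.

End Assemble.

(** * The trees and the unicyclic graphs *)

Definition adjacent (es : seq (nat * nat)) i j := ((i, j) \in es) || ((j, i) \in es).

(** One round of Bellman-Ford; [n] serves as infinity, since distances in a connected graph of order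
    [n] are smaller. *)
Definition relax (es : seq (nat * nat)) n (t : seq (seq nat)) :=
  [seq [seq if i == j then 0 else
      (foldr minn n [seq entry t l j | l <- iota 0 n & adjacent es i l]).+1
    | j <- iota 0 n] | i <- iota 0 n].

Definition dist_table n es :=
  iter n (relax es n) [seq [seq if i == j then 0 else n | j <- iota 0 n] | i <- iota 0 n].

Definition point_table := Eval vm_compute in dist_table 1 [::].

Definition twig_table := Eval vm_compute in dist_table 3 [:: (0, 1); (1, 2)].

Definition long_twig_table := Eval vm_compute in
  dist_table 5 [:: (0, 1); (1, 2); (2, 3); (3, 4)].

Definition fork_table := Eval vm_compute in
  dist_table 5 [:: (0, 1); (0, 2); (1, 3); (3, 4)].

(* In the four tables below vertex [x] of the tree and vertex [x] of the
   unicyclic graph have the same status and the same distance to vertex 0. *)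
Definition tree10_table := Eval vm_compute in
  dist_table 10 [:: (0, 1); (0, 2); (1, 4); (1, 5); (1, 6); (1, 7); (2, 3);
                    (3, 8); (3, 9)].

Definition unicyclic10_table := Eval vm_compute in
  dist_table 10 [:: (0, 1); (0, 2); (1, 3); (1, 4); (1, 5); (3, 8);
                    (2, 6); (6, 9); (9, 7); (7, 2)].

Definition tree15_table := Eval vm_compute in
  dist_table 15 [:: (0, 1); (0, 2); (1, 3); (1, 5); (1, 6); (3, 8); (3, 9); (5, 10);
                    (8, 13); (2, 4); (4, 7); (7, 11); (7, 12); (11, 14)].

Definition unicyclic15_table := Eval vm_compute in
  dist_table 15 [:: (0, 1); (0, 2); (1, 3); (1, 5); (1, 6); (3, 7); (5, 10); (7, 11);
                    (11, 14); (2, 4); (4, 8); (8, 12); (12, 9); (9, 4); (8, 13)].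

Lemma point_metric : table_metricb point_table. Proof. by vm_compute. Qed.
Lemma twig_metric : table_metricb twig_table. Proof. by vm_compute. Qed.
Lemma long_twig_metric : table_metricb long_twig_table. Proof. by vm_compute. Qed.
Lemma fork_metric : table_metricb fork_table. Proof. by vm_compute. Qed.
Lemma tree10_metric : table_metricb tree10_table. Proof. by vm_compute. Qed.
Lemma unicyclic10_metric : table_metricb unicyclic10_table. Proof. by vm_compute. Qed.
Lemma tree15_metric : table_metricb tree15_table. Proof. by vm_compute. Qed.
Lemma unicyclic15_metric : table_metricb unicyclic15_table. Proof. by vm_compute. Qed.

Definition point := Hair point_metric.
Definition twig := Hair twig_metric.
Definition long_twig := Hair long_twig_metric.
Definition fork := Hair fork_metric.
Definition tree10 := Hair tree10_metric.
Definition unicyclic10 := Hair unicyclic10_metric.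
Definition tree15 := Hair tree15_metric.
Definition unicyclic15 := Hair unicyclic15_metric.

Definition tree_gadget n := if n < 15 then tree10 else tree15.
Definition unicyclic_gadget n := if n < 15 then unicyclic10 else unicyclic15.

(** A fork adds 4 vertices and [tree15] adds 14, so they first fit together at order 19. *)
Definition branch n :=
  if n < 19 then point else if n == 34 then long_twig
  else if odd n || (n == 22) then fork else twig.

(* An entry [(n, (q, p))] puts the gadget at [q] and the branch at [p]: for these [n]
   the default positions would not make the statuses distinct. *)
Definition special_positions : seq (nat * (nat * nat)) :=
  [:: (22, (0, 3)); (27, (0, 1)); (28, (3, 7)); (31, (1, 5)); (34, (12, 6));
      (35, (2, 2)); (40, (1, 5)); (43, (1, 4)); (51, (0, 8));
      (58, (16, 18)); (63, (0, 14)); (72, (1, 20))].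

(** For large [n] the default nearly balances the graph at [p]: [p + 14] vertices lie on the gadget
    side, and [p + 12] or [p + 15] on the other side for [n] odd or even. *)
Definition positions n :=
  if [seq x <- special_positions | x.1 == n] is x :: _ then x.2
  else (0, n./2 - (if odd n then 15 else 16)).

Definition path_length n :=
  n.-1 - (size (branch n)).-1 - (size (tree_gadget n)).-1.

Definition host n : hair -> sgraph :=
  assemble (path_length n) (positions n).2 (positions n).1 (branch n).

Definition status_values n :=
  statuses (path_length n) (positions n).2 (positions n).1 (branch n) (tree_gadget n).

Lemma positions_default n :
  72 < n -> positions n = (0, n./2 - (if odd n then 15 else 16)).
Proof.
move=> n_gt; rewrite /positions.
have -> // : [seq x <- special_positions | x.1 == n] = [::].
by rewrite /=; do 12 (case: eqP => [?|_]; first by lia).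
Qed.

Lemma branch_default n : 72 < n -> branch n = if odd n then fork else twig.
Proof.
move=> n_gt; rewrite /branch.
have -> : (n < 19) = false by lia.
have [-> ->] : (n == 34) = false /\ (n == 22) = false by split; lia.
by rewrite orbF.
Qed.

Lemma tree_gadget_default n : 15 <= n -> tree_gadget n = tree15.
Proof. by move=> n_ge; rewrite /tree_gadget ltnNge n_ge. Qed.

Lemma path_length_default n :
  72 < n -> path_length n = if odd n then n - 19 else n - 17.
Proof.
move=> n_gt; rewrite /path_length branch_default // tree_gadget_default; last by lia.
by case: odd => /=; lia.
Qed.

Lemma host_range n : 10 <= n ->
  [/\ (positions n).2 <= path_length n, (positions n).1 <= path_length n
    & path_length n + (size (branch n)).-1 + (size (tree_gadget n)).-1 = n.-1].
Proof.
move=> n_ge; case: (ltnP 72 n) => [n_gt|n_le].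
  rewrite /= positions_default // path_length_default // branch_default //.
  rewrite tree_gadget_default /=; last by lia.
  by case: ifP => odd_n /=; split; lia.
suff /allP/(_ n) : all (fun n =>
    [&& (positions n).2 <= path_length n, (positions n).1 <= path_length n
      & path_length n + (size (branch n)).-1 + (size (tree_gadget n)).-1 == n.-1])
    (iota 10 63).
  by rewrite mem_iota n_ge => /(_ _)/and3P[|-> -> /eqP->]; first by lia.
by vm_compute.
Qed.

Lemma size_gadget n : size (unicyclic_gadget n) = size (tree_gadget n).
Proof. by rewrite /unicyclic_gadget /tree_gadget; case: ifP. Qed.

Lemma branch_tree n : table_treeb (branch n).
Proof. by rewrite /branch; do 3?[case: ifP => _ //]. Qed.

Lemma host_tree n : is_tree (host n (tree_gadget n)).
Proof.
apply: assemble_tree; first exact: branch_tree.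
by rewrite /tree_gadget; case: ifP => _; vm_compute.
Qed.

Lemma host_unicyclic n : unicyclic (host n (unicyclic_gadget n)).
Proof.
(* The 4-cycles of the two unicyclic tables. *)
apply: (@assemble_unicyclic _ _ _ _ _
  (if n < 15 then [:: 2; 6; 9; 7] else [:: 4; 8; 12; 9])); first exact: branch_tree.
by rewrite /unicyclic_gadget; case: ifP => _; vm_compute.
Qed.

Lemma card_host n (A : hair) :
  10 <= n -> size A = size (tree_gadget n) -> #|host n A| = n.
Proof.
move=> n_ge sA; have [_ _ len] := host_range n_ge.
by rewrite /host card_assemble sA addSn addSn len prednK //; apply: leq_trans n_ge.
Qed.

Lemma host_status_seq n : 10 <= n ->
  status_seq (host n (tree_gadget n)) = status_seq (host n (unicyclic_gadget n)).
Proof.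
move=> n_ge; have [lep leq _] := host_range n_ge.
apply: assemble_status_seq => //; rewrite ?size_gadget //;
by rewrite /tree_gadget /unicyclic_gadget; case: ifP => _; vm_compute.
Qed.

Lemma host_injective n :
  10 <= n -> uniq (status_values n) -> status_injective (host n (tree_gadget n)).
Proof. by move=> n_ge; have [lep leq _] := host_range n_ge; apply: assemble_injective. Qed.

(** * Status injectivity *)

(** The range ends at 72, the last order with a special position. *)
Lemma small_odd_uniq :
  all (fun n => (n %% 4 == 3) ==> uniq (status_values n)) (iota 15 58).
Proof. by vm_compute. Qed.

Lemma small_even_uniq :
  all (fun n => odd n || has (fun i => uniq (status_values (n + i))) [:: 0; 2; 4; 6])
    (iota 16 86).
Proof. by vm_compute. Qed.

Lemma double_path_sum m i j : i + j = m ->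
  (path_sum m i).*2 = i * i.+1 + j.+1 * j.
Proof.
move=> ijm; have lti : i < m.+1 by lia.
rewrite -[i in path_sum _ i]/(val (Ordinal lti)) -path_sumE path_dist_sum /=.
by rewrite -ijm -addnS !addKn.
Qed.

(** Sortedness reduces the distinctness of the values off the path to consecutive comparisons. *)
Lemma statuses_uniq m p q (E A : hair)
    (s := [seq branch_status m p q E A x | x <- iota 1 (size E).-1] ++
          [seq gadget_status m p q E ds | ds <- profile A]) :
  {in iota 0 m.+1 &, injective (spine_status m p q E A)} ->
  sorted ltn s ->
  (forall i, i <= m -> spine_status m p q E A i \notin s) ->
  uniq (statuses m p q E A).
Proof.
move=> inj_s sorted_s spine_s; rewrite /statuses cat_uniq -/s.
rewrite map_inj_in_uniq // iota_uniq (sorted_uniq ltn_trans ltnn sorted_s) andbT.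
apply/hasPn => v vs; apply/negP => /mapP[i].
rewrite mem_iota add0n ltnS => /andP[_ lei] vE.
by have := spine_s i lei; rewrite -vE vs.
Qed.

Lemma square_mod8 X : exists r, [\/ X * X = 8 * r, X * X = 8 * r + 1 | X * X = 8 * r + 4].
Proof.
exists (X * X %/ 8); have := divn_eq X 4; have : X %% 4 < 4 by rewrite ltn_mod.
move: (X %/ 4) (X %% 4) => a b b4 ->.
case: b b4 => [|[|[|[|//]]]] _.
- by apply: Or31; lia.
- by apply: Or32; lia.
- by apply: Or33; lia.
- by apply: Or32; lia.
Qed.

Lemma fork_profile :
  [seq (entry fork 0 x, row_sum fork x) | x <- iota 1 (size fork).-1]
  = [:: (1, 6); (1, 10); (2, 7); (3, 10)].
Proof. by vm_compute. Qed.

Lemma tree15_profile :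
  profile tree15 =
  [:: (1, 38); (1, 42); (2, 45); (2, 47); (2, 49); (2, 51); (3, 54); (3, 56); (3, 58);
      (3, 62); (4, 65); (4, 67); (4, 69); (5, 78)].
Proof. by vm_compute. Qed.

(** * Large orders congruent to 3 modulo 4 *)

Section LargeOdd.

Variable a : nat.
(** The order is [4 * a + 67], and [m - p = p + 12]. *)
Let m := 4 * a + 48.
Let p := 2 * a + 18.
Let f := spine_status m p 0 fork tree15.

Lemma odd_spineE i : f i =
  path_sum m i + (4 * gap i p + 7) + (14 * gap i 0 + 39).
Proof. by []. Qed.

(** A step along an edge changes the status by the difference of the orders of its two sides.
    Leftwards from [p] these differences are 3, 5, 7 and so on; rightwards they are 7, 9, 11 and so
    on. *)
Lemma odd_spine_left x : x <= p -> f (p - x) + 1 = f p + (x + 1) * (x + 1).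
Proof.
move=> lexp; rewrite !odd_spineE /gap.
have [r pE] : exists r, p = x + r by exists (p - x); rewrite subnKC.
have mE : m = 2 * (x + r) + 12 by rewrite -pE /m /p; lia.
have e1 : (path_sum m (p - x)).*2 = r * r.+1 + (2 * x + r + 12).+1 * (2 * x + r + 12).
  by rewrite pE addKn; apply: double_path_sum; lia.
have e2 : (path_sum m p).*2 = p * p.+1 + (p + 12).+1 * (p + 12).
  by apply: double_path_sum; lia.
rewrite pE addKn in e1 e2 *; lia.
Qed.

Lemma odd_spine_right y : p + y <= m -> f (p + y) + 9 = f p + (y + 3) * (y + 3).
Proof.
move=> leym; rewrite !odd_spineE /gap.
have [r rE] : exists r, p + 12 = y + r by exists (p + 12 - y); rewrite /m /p in leym *; lia.
have mE : m = p + y + r by rewrite -addnA -rE /m /p; lia.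
have e1 := double_path_sum (esym mE).
have e2 : (path_sum m p).*2 = p * p.+1 + (p + 12).+1 * (p + 12).
  by apply: double_path_sum; lia.
(* Linear arithmetic takes products as atoms, so two quadratic consequences of [rE] are supplied. *)
have rr : (p + 12) * (p + 12) = (y + r) * (y + r) by rewrite rE.
have ry : (p + 12) * y = (y + r) * y by rewrite rE.
by lia.
Qed.

Lemma odd_spine_zero : f 0 + 1 = f p + (2 * a + 19) * (2 * a + 19).
Proof. by have := odd_spine_left (leqnn p); rewrite subnn => ->; rewrite /p; lia. Qed.

(** The slope is [m + 14], the number of vertices outside the branch, and 7 is the row sum of the
    root of [fork]. *)
Lemma odd_branch x : branch_status m p 0 fork tree15 x + 7 =
  f p + (4 * a + 62) * entry fork 0 x + row_sum fork x.
Proof.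
rewrite odd_spineE /branch_status (_ : (size tree15).-1 = 14) //.
by rewrite (_ : row_sum tree15 0 = 39) // /gap /m /p; lia.
Qed.

Lemma odd_gadget ds : gadget_status m p 0 fork ds + 39 =
  f 0 + (4 * a + 52) * ds.1 + ds.2.
Proof.
rewrite odd_spineE /gadget_status (_ : (size fork).-1 = 4) //.
by rewrite (_ : row_sum fork 0 = 7) // /gap /m /p; lia.
Qed.

Lemma odd_spine_cases i : i <= m ->
  (i <= p /\ f i + 1 = f p + (p - i + 1) * (p - i + 1)) \/
  (p < i /\ f i + 9 = f p + (i - p + 3) * (i - p + 3)).
Proof.
move=> leim; case: (leqP i p) => [leip|ltpi]; [left | right]; split=> //.
  by have := @odd_spine_left (p - i) (leq_subr i p); rewrite subKn.
by have := @odd_spine_right (i - p); rewrite (subnKC (ltnW ltpi)) => /(_ leim).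
Qed.

Lemma odd_spine_inj : {in iota 0 m.+1 &, injective f}.
Proof.
(* The only positive squares differing by 8 are 1 and 9. *)
have cross X Y : 0 < X -> 3 < Y -> X * X + 8 <> Y * Y.
  move=> X0 Y3 XY; case: (leqP Y X) => [leYX|ltXY].
    by have := leq_mul leYX leYX; lia.
  case: (leqP (X + 3) Y) => [le3|lt3]; first by have := leq_mul le3 le3; lia.
  have [YE|YE] : Y = X + 1 \/ Y = X + 2 by lia.
    by rewrite YE in XY; lia.
  by rewrite YE in XY; lia.
have sq_inj X Y : X * X = Y * Y -> X = Y.
  by move/eqP; rewrite !mulnn eqn_sqr => /eqP.
move=> i j; rewrite !mem_iota !add0n !ltnS => /andP[_ lei] /andP[_ lej] fij.
case: (odd_spine_cases lei) (odd_spine_cases lej) => -[ip fi] [] [jp fj].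
- by have := @sq_inj (p - i + 1) (p - j + 1); lia.
- by case: (@cross (p - i + 1) (j - p + 3)); lia.
- by case: (@cross (p - j + 1) (i - p + 3)); lia.
- by have := @sq_inj (i - p + 3) (j - p + 3); lia.
Qed.

Lemma odd_uniq : uniq (statuses m p 0 fork tree15).
Proof.
have zero := odd_spine_zero.
have branchE : [seq branch_status m p 0 fork tree15 x | x <- iota 1 (size fork).-1] =
    [seq f p + (4 * a + 62) * ds.1 + ds.2 - 7 | ds <-
       [:: (1, 6); (1, 10); (2, 7); (3, 10)]].
  rewrite -fork_profile -map_comp; apply: eq_map => x.
  by rewrite -[LHS](addnK 7) odd_branch.
have gadgetE : [seq gadget_status m p 0 fork ds | ds <- profile tree15] =
    [seq f 0 + (4 * a + 52) * ds.1 + ds.2 - 39 | ds <- profile tree15].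
  by apply: eq_map => ds; rewrite -[LHS](addnK 39) odd_gadget.
apply: statuses_uniq; first exact: odd_spine_inj.
  rewrite branchE gadgetE tree15_profile /= {branchE gadgetE}.
  (* This linear lower bound on the square in [zero] puts the branch values below the gadget
     values. *)
  have sq := leq_mul (leq_addl (2 * a) 19) (leqnn (2 * a + 19)).
  by do !(apply/andP; split); lia.
move=> i lei; rewrite mem_cat branchE gadgetE tree15_profile {branchE gadgetE} -/f.
have := odd_spine_cases lei; rewrite -/f /= !inE !negb_or.
have le_left : p - i + 1 <= 2 * a + 19 by rewrite /p; lia.
have le_right : i - p + 3 <= 2 * a + 33 by rewrite /p /m in lei *; lia.
move: (f i) (f 0) (f p) zero (p - i + 1) (i - p + 3) le_left le_right.
move=> v v0 vp zero X Y le_left le_right v_cases {lei}.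
apply/andP; split.
  (* A collision would give a square congruent to 2 modulo 4 or to 5 modulo 8. *)
  have [[_ ve]|[_ ve]] := v_cases.
    by have [r [] r8] := square_mod8 X; do !(apply/andP; split); lia.
  by have [r [] r8] := square_mod8 Y; do !(apply/andP; split); lia.
have small Z : Z <= 2 * a + 19 -> Z * Z <= (2 * a + 19) * (2 * a + 19).
  by move=> leZ; apply: leq_mul.
have [[_ ve]|[_ ve]] := v_cases.
  by have sq := small X le_left; do !(apply/andP; split); lia.
case: (leqP Y (2 * a + 19)) => [/small leY|gtY].
  by do !(apply/andP; split); lia.
(* Only the right end of the path rises above [f 0]. For each of the fourteen [j] the excess of
   [Y * Y] over [(2 * a + 19) * (2 * a + 19)] is linear in [a]. *)
have [j YE] : exists j, Y = 2 * a + 20 + j by exists (Y - (2 * a + 20)); lia.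
have ltj : j < 14 by lia.
rewrite {}YE in ve {gtY le_right small}.
by do 14 (case: j ltj ve => [_ ve|j ltj ve]; first by do !(apply/andP; split); lia).
Qed.

End LargeOdd.

(** * Large even orders *)

Lemma twig_profile :
  [seq (entry twig 0 x, row_sum twig x) | x <- iota 1 (size twig).-1] = [:: (1, 2); (2, 3)].
Proof. by vm_compute. Qed.

Section LargeEven.

Variable a : nat.
(** The order is [2 * a + 102], and [m - p = p + 15]. *)
Let m := 2 * a + 85.
Let p := a + 35.
Let f := spine_status m p 0 twig tree15.

Lemma even_spineE i : f i = path_sum m i + (2 * gap i p + 3) + (14 * gap i 0 + 39).
Proof. by []. Qed.

Lemma even_spine_left x : x <= p -> f (p - x) + 2 = f p + (x + 1) * (x + 2).
Proof.
move=> lexp; rewrite !even_spineE /gap.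
have [r pE] : exists r, p = x + r by exists (p - x); rewrite subnKC.
have mE : m = 2 * (x + r) + 15 by rewrite -pE /m /p; lia.
have e1 : (path_sum m (p - x)).*2 = r * r.+1 + (2 * x + r + 15).+1 * (2 * x + r + 15).
  by rewrite pE addKn; apply: double_path_sum; lia.
have e2 : (path_sum m p).*2 = p * p.+1 + (p + 15).+1 * (p + 15).
  by apply: double_path_sum; lia.
by rewrite pE addKn in e1 e2 *; lia.
Qed.

Lemma even_spine_right y : p + y <= m -> f (p + y) = f p + y * (y + 1).
Proof.
move=> leym; rewrite !even_spineE /gap.
have [r rE] : exists r, p + 15 = y + r by exists (p + 15 - y); rewrite /m /p in leym *; lia.
have mE : m = p + y + r by rewrite -addnA -rE /m /p; lia.
have e1 := double_path_sum (esym mE).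
have e2 : (path_sum m p).*2 = p * p.+1 + (p + 15).+1 * (p + 15).
  by apply: double_path_sum; lia.
have rr : (p + 15) * (p + 15) = (y + r) * (y + r) by rewrite rE.
have ry : (p + 15) * y = (y + r) * y by rewrite rE.
by lia.
Qed.

Lemma even_spine_zero : f 0 + 2 = f p + (a + 36) * (a + 37).
Proof. by have := even_spine_left (leqnn p); rewrite subnn => ->; rewrite /p; lia. Qed.

Lemma even_branch x : branch_status m p 0 twig tree15 x + 3 =
  f p + (2 * a + 99) * entry twig 0 x + row_sum twig x.
Proof.
rewrite even_spineE /branch_status (_ : (size tree15).-1 = 14) //.
by rewrite (_ : row_sum tree15 0 = 39) // /gap /m /p; lia.
Qed.

Lemma even_gadget ds : gadget_status m p 0 twig ds + 39 =
  f 0 + (2 * a + 87) * ds.1 + ds.2.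
Proof.
rewrite even_spineE /gadget_status (_ : (size twig).-1 = 2) //.
by rewrite (_ : row_sum twig 0 = 3) // /gap /m /p; lia.
Qed.

Lemma even_spine_cases i : i <= m ->
  (i <= p /\ f i + 2 = f p + (p - i + 1) * (p - i + 1 + 1)) \/
  (p < i /\ f i = f p + (i - p) * (i - p + 1)).
Proof.
move=> leim; case: (leqP i p) => [leip|ltpi]; [left | right]; split=> //.
  by have := @even_spine_left (p - i) (leq_subr i p); rewrite subKn // -addnA.
by have := @even_spine_right (i - p); rewrite (subnKC (ltnW ltpi)) => /(_ leim).
Qed.

Lemma pronic_inj X Y : X * (X + 1) = Y * (Y + 1) -> X = Y.
Proof.
move=> XY; case: (ltngtP X Y) => // lt; have le2 := leq_mul lt lt; exfalso; lia.
Qed.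

Lemma even_spine_inj : {in iota 0 m.+1 &, injective f}.
Proof.
(* The only pronic numbers differing by 2 are 0 and 2. *)
have cross X Y : 0 < Y -> X * (X + 1) <> Y * (Y + 1) + 2.
  move=> Y0 XY; case: (leqP X Y) => [leXY|ltYX]; first by have := leq_mul leXY leXY; lia.
  case: (leqP (Y + 2) X) => [le2|lt2]; first by have := leq_mul le2 le2; lia.
  have XE : X = Y + 1 by lia.
  by rewrite XE in XY; lia.
move=> i j; rewrite !mem_iota !add0n !ltnS => /andP[_ lei] /andP[_ lej] fij.
case: (even_spine_cases lei) (even_spine_cases lej) => -[ip fi] [] [jp fj].
- by have := @pronic_inj (p - i + 1) (p - j + 1); lia.
- by case: (@cross (p - i + 1) (j - p)); lia.
- by case: (@cross (p - j + 1) (i - p)); lia.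
- by have := @pronic_inj (i - p) (j - p); lia.
Qed.

(** The branch values exceed [f p] by [2 * a + 98] and [4 * a + 198]. A collision on the right half
    makes one of these pronic; on the left half, one of these plus 2. *)
Lemma even_uniq :
  (forall X, X * (X + 1) \notin [:: 2 * a + 98; 2 * a + 100; 4 * a + 198; 4 * a + 200]) ->
  uniq (statuses m p 0 twig tree15).
Proof.
move=> not_pronic; have zero := even_spine_zero.
have branchE : [seq branch_status m p 0 twig tree15 x | x <- iota 1 (size twig).-1] =
    [seq f p + (2 * a + 99) * ds.1 + ds.2 - 3 | ds <- [:: (1, 2); (2, 3)]].
  rewrite -twig_profile -map_comp; apply: eq_map => x.
  by rewrite -[LHS](addnK 3) even_branch.
have gadgetE : [seq gadget_status m p 0 twig ds | ds <- profile tree15] =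
    [seq f 0 + (2 * a + 87) * ds.1 + ds.2 - 39 | ds <- profile tree15].
  by apply: eq_map => ds; rewrite -[LHS](addnK 39) even_gadget.
apply: statuses_uniq; first exact: even_spine_inj.
  rewrite branchE gadgetE tree15_profile /= {branchE gadgetE}.
  have sq := leq_mul (leq_addl a 36) (leqnn (a + 37)).
  by do !(apply/andP; split); lia.
move=> i lei; rewrite mem_cat branchE gadgetE tree15_profile {branchE gadgetE} -/f.
have := even_spine_cases lei; rewrite -/f /= !inE !negb_or.
have le_left : p - i + 1 <= a + 36 by rewrite /p; lia.
have le_right : i - p <= a + 50 by rewrite /p /m in lei *; lia.
move: (f i) (f 0) (f p) zero (p - i + 1) (i - p) le_left le_right.
move=> v v0 vp zero X Y le_left le_right v_cases {lei}.
apply/andP; split.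
  have := not_pronic X; have := not_pronic Y.
  rewrite !inE !negb_or => /and4P[Y1 Y2 Y3 Y4] /and4P[X1 X2 X3 X4].
  by have [[_ ve]|[_ ve]] := v_cases; do !(apply/andP; split); lia.
have small Z : Z <= a + 36 -> Z * (Z + 1) <= (a + 36) * (a + 37).
  by move=> leZ; apply: leq_mul; lia.
have [[_ ve]|[_ ve]] := v_cases.
  by have sq := small X le_left; do !(apply/andP; split); lia.
case: (leqP Y (a + 36)) => [/small leY|gtY].
  by do !(apply/andP; split); lia.
have [j YE] : exists j, Y = a + 37 + j by exists (Y - (a + 37)); lia.
have ltj : j < 14 by lia.
rewrite {}YE in ve {gtY le_right small}.
by do 14 (case: j ltj ve => [_ ve|j ltj ve]; first by do !(apply/andP; split); lia).
Qed.

End LargeEven.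

(** * Large orders and windows free of pronic numbers *)

Lemma large_odd_uniq n : 72 < n -> n %% 4 = 3 -> uniq (status_values n).
Proof.
move=> n_gt n3; have [a nE] : exists a, n = 4 * a + 67 by exists ((n - 67) %/ 4); lia.
have odd_n : odd n by lia.
rewrite /status_values path_length_default // positions_default // branch_default //.
rewrite tree_gadget_default; last by lia.
rewrite odd_n /=; have -> : n - 19 = 4 * a + 48 by lia.
have -> : n./2 - 15 = 2 * a + 18 by lia.
exact: odd_uniq.
Qed.

Lemma large_even_uniq n : 102 <= n -> ~~ odd n ->
  (forall X, X * (X + 1) \notin [:: n - 4; n - 2; 2 * n - 6; 2 * n - 4]) ->
  uniq (status_values n).
Proof.
move=> n_ge even_n not_pronic.
have [a nE] : exists a, n = 2 * a + 102 by exists ((n - 102) %/ 2); lia.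
rewrite /status_values path_length_default ?positions_default ?branch_default; try lia.
rewrite tree_gadget_default; last by lia.
rewrite (negPf even_n) /=; have -> : n - 17 = 2 * a + 85 by lia.
have -> : n./2 - 16 = a + 35 by lia.
apply: even_uniq => X; have := not_pronic X; rewrite !inE.
by have [-> -> -> ->] : [/\ n - 4 = 2 * a + 98, n - 2 = 2 * a + 100,
  2 * n - 6 = 4 * a + 198 & 2 * n - 4 = 4 * a + 200] by split; lia.
Qed.

(** Take [b] minimal; [b * (b + 1) + 2 * (b + 1)] is the following pronic number
    [(b + 1) * (b + 2)]. *)
Lemma next_pronic u : exists2 b, u <= b * (b + 1)
  & forall X, u <= X * (X + 1) -> X = b \/ b * (b + 1) + 2 * (b + 1) <= X * (X + 1).
Proof.
have ex_b : exists b, u <= b * (b + 1) by exists u; nia.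
case: (ex_minnP ex_b) => b leub min_b; exists b => // X /min_b.
rewrite leq_eqVlt => /orP[/eqP->|ltbX]; first by left.
by right; have := leq_mul ltbX ltbX; lia.
Qed.

(* The first pronic number from [n - 4] on excludes at most two of the four
   integers and the first one from [2 n - 6] on at most one; the next pronic
   numbers are out of range. *)
Lemma pronic_free_window n : 102 <= n -> ~~ odd n -> exists2 i, i \in [:: 0; 2; 4; 6]
  & forall X, X * (X + 1) \notin
      [:: n + i - 4; n + i - 2; 2 * (n + i) - 6; 2 * (n + i) - 4].
Proof.
move=> n_ge even_n.
have [b leb next_b] := next_pronic (n - 4).
have [c lec next_c] := next_pronic (2 * n - 6).
(* The gaps to the following pronic numbers are then at least 14 and 18, more than the widths 8 and
   14 of the two ranges of forbidden values. *)
have b_gt : 5 < b by rewrite ltnNge; apply/negP=> le5; have := leq_mul le5 le5; lia.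
have c_gt : 7 < c by rewrite ltnNge; apply/negP=> le7; have := leq_mul le7 le7; lia.
pose free i := [&& b * (b + 1) != n + i - 4, b * (b + 1) != n + i - 2,
  c * (c + 1) != 2 * (n + i) - 6 & c * (c + 1) != 2 * (n + i) - 4].
have freeP i : i <= 6 -> free i -> forall X, X * (X + 1) \notin
    [:: n + i - 4; n + i - 2; 2 * (n + i) - 6; 2 * (n + i) - 4].
  move=> le6 /and4P[b1 b2 c1 c2] X; apply/negP; rewrite !inE => XE.
  have [le4|] := leqP (n - 4) (X * (X + 1)); last by lia.
  case: (next_b X le4) => [Xb'|bX].
    subst X; case: (leqP (2 * n - 6) (b * (b + 1))) => [/next_c[Xc|cX]|lt6].
    - by subst c; lia.
    - by lia.
    - by lia.
  case: (leqP (2 * n - 6) (X * (X + 1))) => [/next_c[Xc|cX]|lt6]; last by lia.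
    by subst X; lia.
  by lia.
have [f0|[f2|[f4|f6]]] : free 0 \/ free 2 \/ free 4 \/ free 6.
- move: (b * (b + 1)) (c * (c + 1)) @free freeP => beta gamma free _.
  by rewrite /free; lia.
- by exists 0 => //; apply: freeP.
- by exists 2 => //; apply: freeP.
- by exists 4 => //; apply: freeP.
- by exists 6 => //; apply: freeP.
Qed.

Theorem theorem5 :
  exists T U : nat -> sgraph,
    [/\ forall n : nat, 10 <= n ->
          [/\ is_tree (T n), unicyclic (U n), #|T n| = n & #|U n| = n],
        forall n : nat, 10 <= n -> status_seq (T n) = status_seq (U n),
        forall n : nat, 15 <= n -> n = 3 %[mod 4] -> status_injective (T n)
      & forall n : nat, 15 <= n -> ~~ odd n ->
          [\/ status_injective (T n), status_injective (T (n + 2)),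
              status_injective (T (n + 4)) | status_injective (T (n + 6))]].
Proof.
exists (fun n => host n (tree_gadget n)), (fun n => host n (unicyclic_gadget n)).
have injT n : 15 <= n -> uniq (status_values n) -> status_injective (host n (tree_gadget n)).
  by move=> n_ge; apply: host_injective; apply: leq_trans n_ge.
split.
- move=> n n_ge; split; [exact: host_tree | exact: host_unicyclic | |].
    exact: card_host.
  by apply: card_host => //; apply: size_gadget.
- exact: host_status_seq.
- move=> n n_ge n3; apply: injT => //; case: (ltnP 72 n) => [n_gt|n_le].
    exact: large_odd_uniq.
  have := allP small_odd_uniq n; rewrite mem_iota n_ge /= n3 eqxx; apply.
  by rewrite -ltnS in n_le.
- move=> n n_ge even_n.
  have [i i6 uniq_i] : exists2 i, i \in [:: 0; 2; 4; 6] & uniq (status_values (n + i)).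
    case: (ltnP n 102) => [n_lt|n_gt].
      have /allP/(_ n) := small_even_uniq.
      rewrite mem_iota (negPf even_n) orFb => /(_ _)/hasP; apply.
      (* Since 15 is odd, [n] is at least 16, where the computed range starts. *)
      by move: n_ge even_n; rewrite leq_eqVlt => /orP[/eqP<-|-> _].
    have [i i6 free_i] := pronic_free_window n_gt even_n.
    exists i => //; apply: large_even_uniq => //; first exact: leq_trans n_gt (leq_addr _ _).
    rewrite oddD (negPf even_n).
    by move: i6; rewrite !inE => /or4P[] /eqP->.
  have {uniq_i}: status_injective (host (n + i) (tree_gadget (n + i))).
    by apply: injT uniq_i; apply: leq_trans n_ge (leq_addr _ _).
  move: i6; rewrite !inE => /or4P[] /eqP->; rewrite ?addn0 => inj.
  + exact: Or41.
  + exact: Or42.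
  + exact: Or43.
  + exact: Or44.
Qed.
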